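(* Let $r<0$ be given. Then there exist a sequence $\{u_0^{(j)}\}_{j=1}^\infty$ of $C^\infty$, $2\pi$-periodic, mean-zero, real-valued functions on $\mathbb{R}$ such that $$u_0^{(j)} \to 0 \quad \text{in } \dot H^r_{per} \quad \text{as } j\to\infty,$$ and a sequence $\{T_j\}_{j=1}^\infty$ of positive real numbers with $T_j \to 0$ as $j\to\infty$, such that, if $u_j(x,t)$ denotes the solution of the $2\pi$-periodic initial-value problem $$u_t+u_x+uu_x-u_{xxt}=0,\qquad u(x,0)=u_0^{(j)}(x),$$ then $$\|u_j(\cdot,T_j)\|_{\dot H^r_{per}} \ \geq\ j \qquad \text{for all } j=1,2,3,\dots$$
   Context: For $r\in\mathbb{R}$, $\dot H^r_{per}$ is the homogeneous Sobolev space of $2\pi$-periodic distributions $f$ with mean zero over the period domain $[0,2\pi]$ whose norm $$\|f\|_{\dot H^r_{per}}^2=\sum_{k=1}^\infty k^{2r}\left(|f_k|^2+|g_k|^2\right)$$ is finite, where $f_k$ and $g_k$ are respectively the Fourier sine and Fourier cosine coefficients of $f$, i.e. $f=\sum_{k\ge 1}\left(f_k\sin(kx)+g_k\cos(kx)\right)$. The equation $u_t+u_x+uu_x-u_{xxt}=0$ is the regularized long-wave (BBM) equation, considered here for functions $u(x,t)$ that are $2\pi$-periodic in $x$, with $t\ge 0$. For each smooth, $2\pi$-periodic, mean-zero initial datum, the periodic initial-value problem has a unique, global, smooth solution, which is $2\pi$-periodic in $x$. It has mean zero in $x$ for all $t\geq 0$, and so lies in $C([0,T];\dot H^\rho_{per})$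 for all $T>0$ and all $\rho\in\mathbb{R}$. ''The solution'' $u_j$ refers to this solution. *)

(* Defs.v *)
From Stdlib Require Import Reals.
From Coquelicot Require Import Coquelicot.
Open Scope R_scope.

Definition smooth (f : R -> R) : Prop := forall n x, ex_derive_n f n x.

Definition periodic (f : R -> R) : Prop := forall x, f (x + 2 * PI) = f x.

Definition mean_zero (f : R -> R) : Prop := is_RInt f 0 (2 * PI) 0.

Definition test_function (phi : R -> R) : Prop := smooth phi /\ periodic phi.

(* Real 2pi-periodic distributions, as functionals on periodic test functions;
   the value of the functional on any other function is irrelevant. *)
Record periodic_distribution (F : (R -> R) -> R) : Prop := {
  distribution_linear : forall a b phi psi,
    test_function phi -> test_function psi ->
    F (fun x => a * phi x + b * psi x) = a * F phi + b * F psi;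
  distribution_continuous : exists (N : nat) (C : R), forall phi M,
    test_function phi ->
    (forall n x, (n <= N)%nat -> Rabs (Derive_n phi n x) <= M) ->
    Rabs (F phi) <= C * M
}.

Definition distribution_of (f : R -> R) : (R -> R) -> R :=
  fun phi => RInt (fun x => f x * phi x) 0 (2 * PI).

(* Normalized so that a smooth mean-zero f is the sum over k >= 1 of
   sin_coef f k * sin (k x) + cos_coef f k * cos (k x). *)
Definition sin_coef (F : (R -> R) -> R) (k : nat) : R :=
  F (fun x => sin (INR k * x)) / PI.

Definition cos_coef (F : (R -> R) -> R) (k : nat) : R :=
  F (fun x => cos (INR k * x)) / PI.

(* Index n stands for frequency k = n + 1. *)
Definition Hdot_term (r : R) (F : (R -> R) -> R) (n : nat) : R :=
  Rpower (INR (S n)) (2 * r) *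
  (Rabs (sin_coef F (S n)) ^ 2 + Rabs (cos_coef F (S n)) ^ 2).

Definition in_Hdot (r : R) (F : (R -> R) -> R) : Prop :=
  periodic_distribution F /\ F (fun _ => 1) = 0 /\ ex_series (Hdot_term r F).

(* Meaningful only under [in_Hdot r F]: [Series] has a junk value on divergent
   series. *)
Definition Hdot_norm (r : R) (F : (R -> R) -> R) : R :=
  sqrt (Series (Hdot_term r F)).

(* u is C^infinity on R x [0, +oo), with D m n the derivative of order m in x
   and n in t.  Time derivatives are taken at t > 0 only; joint continuity down
   to t = 0 makes D m (S n) the one-sided derivative there. The values of u and
   D at t < 0 play no role. *)
Definition smooth_partials (u : R -> R -> R) (D : nat -> nat -> R -> R -> R)
    : Prop :=
  (forall x t, 0 <= t -> D 0%nat 0%nat x t = u x t) /\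
  (forall m n x t, 0 <= t ->
     is_derive (fun y => D m n y t) x (D (S m) n x t)) /\
  (forall m n x t, 0 < t ->
     is_derive (fun s => D m n x s) t (D m (S n) x t)) /\
  (forall m n x t, 0 <= t ->
     filterlim (fun p : R * R => D m n (fst p) (snd p))
       (within (fun p : R * R => 0 <= snd p) (locally (x, t)))
       (locally (D m n x t))).

(* Smooth global solution of u_t + u_x + u u_x - u_xxt = 0, u(., 0) = u0. *)
Definition BBM_solution (u0 : R -> R) (u : R -> R -> R) : Prop :=
  (forall t, 0 <= t -> periodic (fun x => u x t)) /\
  (forall x, u x 0 = u0 x) /\
  exists D, smooth_partials u D /\
    forall x t, 0 <= t ->
      D 0%nat 1%nat x t + D 1%nat 0%nat x t + u x t * D 1%nat 0%nat x t
      - D 2%nat 1%nat x t = 0.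

(* Main.v *)
Require Import Defs.
From Stdlib Require Import Reals ZArith Lra Lia Psatz FunctionalExtensionality.
From Coquelicot Require Import Coquelicot.
Open Scope R_scope.

(** Norm inflation comes from a high-high-to-low interaction.  Take the datum
    [packet A k], that is A (cos kx + cos (k+1)x) with k huge.  Its norm in
    H^r is of order A k^r, which for r < 0 is as small as desired once A is
    fixed, but its square contains A^2 cos x, whatever k is.  The nonlinearity
    turns this into growth of the sin x coefficient at a rate of order A^2,
    and the frequency 1 has weight 1 in every H^r.

    All that remains is to see that the solution stays close to the datum long
    enough, with constants that do not depend on k; this rules out the
    conserved energy, which is of size (A k)^2.  At a fixed time, v = u_t
    solves v - v_xx + g_x = 0 with g = u + u^2 / 2, and this nonlocal
    dependence of v on g is bounded in the sup norm: |v| <= sup |g|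
    ([elliptic_sup_bound]).  Hence as long as |u| <= 3A one has
    |u_t| <= (15/2) A^2, and a continuity argument in time
    ([solution_near_data]) gives |u - u0| <= (15/2) A^2 t for 0 <= t <= T as
    soon as A T is small.  Pairing the equation with sin x gives
    d/dt (integral of u sin x) = 1/2 (integral of g cos x)
    ([elliptic_sine_mode]).  For u = u0 the right-hand side is pi A^2 / 4
    ([is_RInt_packet_sqr_cos]), and if A T <= 1/210 replacing u0 by u costs at
    most half of it.  So at time T the sine coefficient of frequency 1 is at
    least A^2 T / 8 ([packet_first_mode_growth]).

    With A T = 1/210 this bound is A / 1680.  The theorem follows with
    A = 1680 (j+1), T = 1 / (210 A), which tends to 0, and k chosen last
    ([frequency]) so that the datum has norm at most 1 / (j+1).  Only a priori
    estimates enter: they hold for any solution with the given datum. *)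

(** * Calculus on the line *)

Lemma two_PI_pos : 0 < 2 * PI.
Proof. generalize PI_RGT_0; lra. Qed.

Lemma is_derive_continuous (f : R -> R) (x l : R) :
  is_derive f x l -> continuous f x.
Proof. intros H; apply (ex_derive_continuous (V := R_NormedModule)); now exists l. Qed.

Lemma continuous_Rmult (f g : R -> R) (x : R) :
  continuous f x -> continuous g x -> continuous (fun y => f y * g y) x.
Proof. exact (continuous_mult (K := R_AbsRing) f g x). Qed.

Lemma is_RInt_eq (f : R -> R) (a b l : R) : is_RInt f a b l -> RInt f a b = l.
Proof. exact (is_RInt_unique (V := R_CompleteNormedModule) f a b l). Qed.

Lemma is_RInt_Rext (f g : R -> R) (a b l : R) :
  (forall x, f x = g x) -> is_RInt f a b l -> is_RInt g a b l.
Proof. intros H; apply is_RInt_ext; intros x _; apply H. Qed.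

Lemma is_RInt_continuous (f : R -> R) (a b : R) :
  (forall x, continuous f x) -> is_RInt f a b (RInt f a b).
Proof.
intros Hf; apply (RInt_correct (V := R_CompleteNormedModule)).
now apply (ex_RInt_continuous (V := R_CompleteNormedModule)).
Qed.

Lemma is_RInt_Rplus (f g : R -> R) (a b lf lg : R) :
  is_RInt f a b lf -> is_RInt g a b lg ->
  is_RInt (fun x => f x + g x) a b (lf + lg).
Proof. exact (is_RInt_plus (V := R_NormedModule) f g a b lf lg). Qed.

Lemma is_RInt_Rscal (f : R -> R) (a b c l : R) :
  is_RInt f a b l -> is_RInt (fun x => c * f x) a b (c * l).
Proof. exact (is_RInt_scal (V := R_NormedModule) f a b c l). Qed.

Lemma RInt_abs_le (f : R -> R) (M : R) :
  (forall x, continuous f x) -> (forall x, 0 <= x <= 2 * PI -> Rabs (f x) <= M) ->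
  Rabs (RInt f 0 (2 * PI)) <= 2 * PI * M.
Proof.
intros Hc HM.
replace (2 * PI * M) with ((2 * PI - 0) * M) by ring.
apply abs_RInt_le_const; [generalize two_PI_pos; lra| |exact HM].
exists (RInt f 0 (2 * PI)); now apply is_RInt_continuous.
Qed.

Lemma continuous_bounded (f : R -> R) :
  (forall x, continuous f x) ->
  exists M, forall x, 0 <= x <= 2 * PI -> Rabs (f x) <= M.
Proof.
intros Hc.
destruct (continuity_ab_maj (fun x => Rabs (f x)) 0 (2 * PI)) as (x0 & H & _).
- generalize two_PI_pos; lra.
- intros x _; apply continuity_pt_filterlim.
  apply (continuous_comp f Rabs); [apply Hc|apply continuous_Rabs].
- now exists (Rabs (f x0)).
Qed.

(** * Periodic functions *)

Lemma periodic_INR (f : R -> R) (n : nat) (x : R) :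
  periodic f -> f (x + 2 * PI * INR n) = f x.
Proof.
intros Hf; induction n as [|n IH].
- now simpl; rewrite Rmult_0_r, Rplus_0_r.
- rewrite S_INR, <- IH, <- (Hf (x + 2 * PI * INR n)).
  f_equal; ring.
Qed.

Lemma periodic_IZR (f : R -> R) (z : Z) (x : R) :
  periodic f -> f (x + 2 * PI * IZR z) = f x.
Proof.
intros Hf; destruct (Z.le_ge_cases 0 z) as [Hz|Hz].
- rewrite <- (Z2Nat.id z Hz), <- INR_IZR_INZ.
  now apply periodic_INR.
- rewrite <- (periodic_INR f (Z.to_nat (- z)) (x + 2 * PI * IZR z) Hf).
  rewrite INR_IZR_INZ, Z2Nat.id by lia.
  rewrite opp_IZR; f_equal; ring.
Qed.

Lemma periodic_bound (f : R -> R) (M : R) :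
  periodic f -> (forall x, 0 <= x <= 2 * PI -> Rabs (f x) <= M) ->
  forall x, Rabs (f x) <= M.
Proof.
intros Hf HM x.
pose proof two_PI_pos as Hpi.
destruct (base_Int_part (x / (2 * PI))) as [H1 H2].
set (z := Int_part (x / (2 * PI))) in *.
rewrite <- (periodic_IZR f (- z) x Hf).
assert (Hx : x = 2 * PI * (x / (2 * PI))) by (field; lra).
apply HM; rewrite opp_IZR.
set (y := x / (2 * PI)) in *; rewrite Hx; nra.
Qed.

Lemma periodic_derivative (f f' : R -> R) :
  periodic f -> (forall x, is_derive f x (f' x)) -> periodic f'.
Proof.
intros Hf Hd x.
rewrite <- (is_derive_unique _ _ _ (Hd x)).
symmetry; apply is_derive_unique.
apply is_derive_ext with (fun y => f (y + 2 * PI)); [exact Hf|].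
replace (f' (x + 2 * PI)) with (scal 1 (f' (x + 2 * PI)))
  by (unfold scal; simpl; unfold mult; simpl; ring).
apply (is_derive_comp f (fun y => y + 2 * PI)).
- apply Hd.
- auto_derive; trivial.
Qed.

(** Every integration by parts over the period below is an instance: an exact
    derivative is integrated, so no boundary term has to be handled. *)
Lemma is_RInt_periodic_derivative (f f' : R -> R) :
  periodic f -> (forall x, is_derive f x (f' x)) ->
  (forall x, continuous f' x) -> is_RInt f' 0 (2 * PI) 0.
Proof.
intros Hf Hd Hc.
replace 0 with (minus (f (2 * PI)) (f 0)) at 2.
- apply (is_RInt_derive (V := R_CompleteNormedModule)); auto.
- rewrite <- (Hf 0), Rplus_0_l; apply Rminus_diag.
Qed.

Lemma sin_mode_periodic (k : nat) : periodic (fun x => sin (INR k * x)).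
Proof.
intros x; replace (INR k * (x + 2 * PI)) with (INR k * x + 2 * INR k * PI) by ring.
apply sin_period.
Qed.

Lemma cos_mode_periodic (k : nat) : periodic (fun x => cos (INR k * x)).
Proof.
intros x; replace (INR k * (x + 2 * PI)) with (INR k * x + 2 * INR k * PI) by ring.
apply cos_period.
Qed.

Lemma continuous_sin_mode (k : nat) (x : R) : continuous (fun y => sin (INR k * y)) x.
Proof. apply (ex_derive_continuous (V := R_NormedModule)); auto_derive; trivial. Qed.

Lemma continuous_cos_mode (k : nat) (x : R) : continuous (fun y => cos (INR k * y)) x.
Proof. apply (ex_derive_continuous (V := R_NormedModule)); auto_derive; trivial. Qed.

(** * The velocity equation at a fixed time *)

(** For the sign c = 1, the function exp (-x) (h - M) is nondecreasing since its
    derivative is exp (-x) (g + M); over one period it is multiplied by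
    exp (-2 pi) < 1, so it cannot be positive anywhere.  For c = -1 the weight
    is exp x and the monotonicity is reversed. *)
Lemma periodic_ode_le (c : R) (h g : R -> R) (M : R) :
  c = 1 \/ c = - 1 -> periodic h ->
  (forall x, is_derive h x (c * h x + g x)) ->
  (forall x, Rabs (g x) <= M) -> forall x, h x <= M.
Proof.
intros Hc Hp Hd Hg x.
pose proof two_PI_pos as Hpi.
set (E := fun y => exp (- (c * y)) * (h y - M)).
set (E' := fun y => exp (- (c * y)) * (g y + c * M)).
assert (HE : forall y, is_derive E y (E' y)).
{ intros y; unfold E, E'.
  assert (Hh := Hd y).
  auto_derive.
  - exists (c * h y + g y); exact Hh.
  - replace (Derive (fun x0 : R => h x0) y) with (c * h y + g y)
      by (symmetry; apply is_derive_unique; exact Hh).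
    ring. }
destruct (MVT_gen E x (x + 2 * PI) E') as (z & _ & Hz).
- intros; apply HE.
- intros y _; apply continuity_pt_filterlim, (is_derive_continuous E y _ (HE y)).
- unfold E, E' in Hz; rewrite Hp in Hz.
  replace (exp (- (c * (x + 2 * PI))))
    with (exp (- (c * x)) * exp (- (c * (2 * PI)))) in Hz
    by (rewrite <- exp_plus; f_equal; ring).
  assert (Hgz := proj1 (Rabs_le_between _ _) (Hg z)).
  assert (Hex := exp_pos (- (c * x))).
  assert (Hez := exp_pos (- (c * z))).
  replace (x + 2 * PI - x) with (2 * PI) in Hz by ring.
  set (p := exp (- (c * (2 * PI)))) in *.
  apply Rnot_lt_le; intros Hlt.
  assert (Hq : 0 < exp (- (c * x)) * (h x - M)) by (apply Rmult_lt_0_compat; lra).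
  set (q := exp (- (c * x)) * (h x - M)) in *.
  replace (exp (- (c * x)) * p * (h x - M) - q) with ((p - 1) * q) in Hz
    by (unfold q; ring).
  set (e := exp (- (c * z))) in *.
  destruct Hc as [-> | ->].
  + assert (p < exp 0) by (apply exp_increasing; lra).
    rewrite exp_0 in *.
    assert (0 <= e * (g z + 1 * M)) by (apply Rmult_le_pos; lra).
    nra.
  + assert (exp 0 < p) by (apply exp_increasing; lra).
    rewrite exp_0 in *.
    assert (0 <= e * (- (g z + - 1 * M))) by (apply Rmult_le_pos; lra).
    nra.
Qed.

Lemma periodic_ode_bound (c : R) (h g : R -> R) (M : R) :
  c = 1 \/ c = - 1 -> periodic h ->
  (forall x, is_derive h x (c * h x + g x)) ->
  (forall x, Rabs (g x) <= M) -> forall x, Rabs (h x) <= M.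
Proof.
intros Hc Hp Hd Hg x; apply Rabs_le; split.
- apply Ropp_le_cancel; rewrite Ropp_involutive.
  apply (periodic_ode_le c (fun y => - h y) (fun y => - g y)); trivial.
  + now intros y; rewrite Hp.
  + intros y.
    replace (c * - h y + - g y) with (opp (c * h y + g y))
      by (unfold opp; simpl; ring).
    apply (is_derive_opp (K := R_AbsRing) (V := R_NormedModule)), Hd.
  + now intros y; rewrite Rabs_Ropp.
- now apply (periodic_ode_le c h g).
Qed.

(** The elliptic problem v - v'' + g' = 0 on the circle, which the velocity of a
    solution satisfies at each time; [v1], [v2] and [g1] are the derivatives. *)
Definition elliptic_data (v v1 v2 g g1 : R -> R) : Prop :=
  periodic v /\ periodic g /\
  (forall x, is_derive v x (v1 x)) /\
  (forall x, is_derive v1 x (v2 x)) /\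
  (forall x, is_derive g x (g1 x)) /\
  (forall x, v x - v2 x + g1 x = 0).

Lemma elliptic_flux_periodic (v v1 v2 g g1 : R -> R) :
  elliptic_data v v1 v2 g g1 -> periodic (fun x => v1 x - g x).
Proof.
intros (Pv & Pg & Dv & _) x.
now rewrite Pg, (periodic_derivative v v1 Pv Dv).
Qed.

Lemma elliptic_flux_derivative (v v1 v2 g g1 : R -> R) :
  elliptic_data v v1 v2 g g1 ->
  forall x, is_derive (fun x => v1 x - g x) x (v x).
Proof.
intros (_ & _ & _ & Dv1 & Dg & Heq) x.
replace (v x) with (minus (v2 x) (g1 x))
  by (unfold minus, plus, opp; simpl; generalize (Heq x); lra).
now apply (is_derive_minus (K := R_AbsRing) (V := R_NormedModule)).
Qed.

(** With the flux q = v' - g, the equation becomes the system q' = v,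
    v' = q + g, which the combinations s = v + q and d = v - q decouple into
    s' = s + g and d' = -d + g.  Both are bounded by M, hence so is
    v = (s + d) / 2. *)
Lemma elliptic_sup_bound (v v1 v2 g g1 : R -> R) (M : R) :
  elliptic_data v v1 v2 g g1 ->
  (forall x, Rabs (g x) <= M) -> forall x, Rabs (v x) <= M.
Proof.
intros HE Hg x.
assert (Pq := elliptic_flux_periodic _ _ _ _ _ HE).
assert (Dq := elliptic_flux_derivative _ _ _ _ _ HE).
destruct HE as (Pv & _ & Dv & _).
assert (Hs : Rabs (v x + (v1 x - g x)) <= M).
{ apply (periodic_ode_bound 1 (fun y => v y + (v1 y - g y)) g); trivial.
  - now left.
  - now intros y; rewrite Pv, (Pq y).
  - intros y.
    replace (1 * (v y + (v1 y - g y)) + g y) with (plus (v1 y) (v y))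
      by (unfold plus; simpl; ring).
    now apply (is_derive_plus (K := R_AbsRing) (V := R_NormedModule)). }
assert (Hd : Rabs (v x - (v1 x - g x)) <= M).
{ apply (periodic_ode_bound (- 1) (fun y => v y - (v1 y - g y)) g); trivial.
  - now right.
  - now intros y; rewrite Pv, (Pq y).
  - intros y.
    replace (- 1 * (v y - (v1 y - g y)) + g y) with (minus (v1 y) (v y))
      by (unfold minus, plus, opp; simpl; ring).
    now apply (is_derive_minus (K := R_AbsRing) (V := R_NormedModule)). }
apply Rabs_le_between in Hs; apply Rabs_le_between in Hd.
apply Rabs_le; lra.
Qed.

Lemma elliptic_mean_zero (v v1 v2 g g1 : R -> R) :
  elliptic_data v v1 v2 g g1 -> is_RInt v 0 (2 * PI) 0.
Proof.
intros HE.
apply (is_RInt_periodic_derivative (fun x => v1 x - g x)).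
- exact (elliptic_flux_periodic _ _ _ _ _ HE).
- exact (elliptic_flux_derivative _ _ _ _ _ HE).
- destruct HE as (_ & _ & Dv & _).
  intros x; exact (is_derive_continuous v x _ (Dv x)).
Qed.

(** Since q' = v for the flux q = v' - g, the function q sin - v cos has
    derivative 2 v sin - g cos. *)
Lemma elliptic_sine_mode (v v1 v2 g g1 : R -> R) :
  elliptic_data v v1 v2 g g1 ->
  RInt (fun x => v x * sin x) 0 (2 * PI) =
  / 2 * RInt (fun x => g x * cos x) 0 (2 * PI).
Proof.
intros HE.
assert (Pq := elliptic_flux_periodic _ _ _ _ _ HE).
assert (Dq := elliptic_flux_derivative _ _ _ _ _ HE).
destruct HE as (Pv & _ & Dv & _ & Dg & _).
assert (Cv : forall x, continuous (fun y => v y * sin y) x).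
{ intros x; apply continuous_Rmult; [exact (is_derive_continuous v x _ (Dv x))|].
  apply continuous_sin. }
assert (Cg : forall x, continuous (fun y => g y * cos y) x).
{ intros x; apply continuous_Rmult; [exact (is_derive_continuous g x _ (Dg x))|].
  apply continuous_cos. }
assert (H0 : is_RInt (fun x => 2 * (v x * sin x) - g x * cos x) 0 (2 * PI) 0).
{ apply (is_RInt_periodic_derivative
           (fun x => (v1 x - g x) * sin x - v x * cos x)).
  - intros x; rewrite (Pq x), Pv.
    replace (x + 2 * PI) with (x + 2 * INR 1 * PI) by (simpl; ring).
    now rewrite sin_period, cos_period.
  - intros x; set (q := fun x => v1 x - g x) in *.
    change (is_derive (fun x => q x * sin x - v x * cos x) x
              (2 * (v x * sin x) - g x * cos x)).
    assert (Dqx := Dq x); assert (Dvx := Dv x).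
    auto_derive.
    + repeat split; [now exists (v x)|now exists (v1 x)].
    + replace (Derive (fun x => q x) x) with (v x)
        by (symmetry; apply is_derive_unique; exact Dqx).
      replace (Derive (fun x => v x) x) with (v1 x)
        by (symmetry; apply is_derive_unique; exact Dvx).
      unfold q; ring.
  - intros x; apply (continuous_minus (K := R_AbsRing) (V := R_NormedModule)).
    + apply continuous_Rmult; [apply continuous_const|apply Cv].
    + apply Cg. }
assert (H1 := is_RInt_minus (V := R_NormedModule) _ _ _ _ _ _
  (is_RInt_scal (V := R_NormedModule) _ _ _ 2 _ (is_RInt_continuous _ 0 (2 * PI) Cv))
  (is_RInt_continuous _ 0 (2 * PI) Cg)).
assert (H2 := eq_trans (eq_sym (is_RInt_eq _ _ _ _ H0)) (is_RInt_eq _ _ _ _ H1)).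
unfold minus, plus, opp, scal in H2; simpl in H2; unfold mult in H2; simpl in H2.
lra.
Qed.

(** * Fourier coefficients and the homogeneous Sobolev norms *)

Section Coefficients.

Variables (f f' : R -> R).
Hypothesis Pf : periodic f.
Hypothesis Df : forall x, is_derive f x (f' x).
Hypothesis Cf' : forall x, continuous f' x.

Let Cf : forall x, continuous f x := fun x => is_derive_continuous f x _ (Df x).

Lemma sin_mode_by_parts (k : nat) :
  INR k * RInt (fun x => f x * sin (INR k * x)) 0 (2 * PI) =
  RInt (fun x => f' x * cos (INR k * x)) 0 (2 * PI).
Proof.
assert (H : is_RInt (fun x => f' x * cos (INR k * x) +
                      (- INR k) * (f x * sin (INR k * x))) 0 (2 * PI) 0).
{ apply (is_RInt_periodic_derivative (fun x => f x * cos (INR k * x))).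
  - intros x; rewrite Pf, (cos_mode_periodic k x); reflexivity.
  - intros x; assert (Dfx := Df x).
    auto_derive; [now exists (f' x)|].
    replace (Derive (fun x => f x) x) with (f' x)
      by (symmetry; apply is_derive_unique; exact Dfx).
    ring.
  - intros x; apply (continuous_plus (K := R_AbsRing) (V := R_NormedModule)).
    + apply continuous_Rmult; [apply Cf'|apply continuous_cos_mode].
    + apply continuous_Rmult; [apply continuous_const|].
      apply continuous_Rmult; [apply Cf|apply continuous_sin_mode]. }
assert (H' : is_RInt (fun x => f' x * cos (INR k * x) +
                      (- INR k) * (f x * sin (INR k * x))) 0 (2 * PI)
   (RInt (fun x => f' x * cos (INR k * x)) 0 (2 * PI) +
    (- INR k) * RInt (fun x => f x * sin (INR k * x)) 0 (2 * PI))).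
{ apply is_RInt_Rplus; [|apply is_RInt_Rscal]; apply is_RInt_continuous; intros x;
  apply continuous_Rmult; trivial using continuous_cos_mode, continuous_sin_mode. }
apply is_RInt_eq in H; apply is_RInt_eq in H'; lra.
Qed.

Lemma cos_mode_by_parts (k : nat) :
  INR k * RInt (fun x => f x * cos (INR k * x)) 0 (2 * PI) =
  - RInt (fun x => f' x * sin (INR k * x)) 0 (2 * PI).
Proof.
assert (H : is_RInt (fun x => f' x * sin (INR k * x) +
                      INR k * (f x * cos (INR k * x))) 0 (2 * PI) 0).
{ apply (is_RInt_periodic_derivative (fun x => f x * sin (INR k * x))).
  - intros x; rewrite Pf, (sin_mode_periodic k x); reflexivity.
  - intros x; assert (Dfx := Df x).
    auto_derive; [now exists (f' x)|].
    replace (Derive (fun x => f x) x) with (f' x)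
      by (symmetry; apply is_derive_unique; exact Dfx).
    ring.
  - intros x; apply (continuous_plus (K := R_AbsRing) (V := R_NormedModule)).
    + apply continuous_Rmult; [apply Cf'|apply continuous_sin_mode].
    + apply continuous_Rmult; [apply continuous_const|].
      apply continuous_Rmult; [apply Cf|apply continuous_cos_mode]. }
assert (H' : is_RInt (fun x => f' x * sin (INR k * x) +
                      INR k * (f x * cos (INR k * x))) 0 (2 * PI)
   (RInt (fun x => f' x * sin (INR k * x)) 0 (2 * PI) +
    INR k * RInt (fun x => f x * cos (INR k * x)) 0 (2 * PI))).
{ apply is_RInt_Rplus; [|apply is_RInt_Rscal]; apply is_RInt_continuous; intros x;
  apply continuous_Rmult; trivial using continuous_cos_mode, continuous_sin_mode. }
apply is_RInt_eq in H; apply is_RInt_eq in H'; lra.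
Qed.

(** One integration by parts, which a C^1 function affords; the square of 1/k is
    already summable, and for r < 0 the weights are at most 1. *)
Lemma coefficient_decay :
  exists C, 0 <= C /\ forall n : nat,
    Rabs (sin_coef (distribution_of f) (S n)) <= C / INR (S n) /\
    Rabs (cos_coef (distribution_of f) (S n)) <= C / INR (S n).
Proof.
destruct (continuous_bounded f' Cf') as (M & HM).
assert (HM0 : 0 <= M).
{ apply Rle_trans with (Rabs (f' 0)); [apply Rabs_pos|apply HM].
  generalize two_PI_pos; lra. }
assert (Hpi := PI_RGT_0).
exists (2 * M); split; [lra|intros n].
assert (Hk : 0 < INR (S n)) by apply lt_0_INR, Nat.lt_0_succ.
assert (Hs : forall I J, INR (S n) * I = J -> Rabs J <= 2 * PI * M ->
               Rabs (I / PI) <= 2 * M / INR (S n)).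
{ intros I J HI HJ.
  unfold Rdiv at 1; rewrite Rabs_mult, (Rabs_pos_eq (/ PI)) by (left; now apply Rinv_0_lt_compat).
  apply Rmult_le_reg_l with (PI * INR (S n)); [now apply Rmult_lt_0_compat|].
  rewrite <- HI, Rabs_mult, (Rabs_pos_eq (INR (S n))) in HJ by lra.
  replace (PI * INR (S n) * (Rabs I * / PI)) with (INR (S n) * Rabs I) by (field; lra).
  replace (PI * INR (S n) * (2 * M / INR (S n))) with (2 * PI * M) by (field; lra).
  exact HJ. }
assert (Hb : forall a b, Rabs a <= M -> Rabs b <= 1 -> Rabs (a * b) <= M).
{ intros a b Ha Hb; rewrite Rabs_mult.
  generalize (Rabs_pos a) (Rabs_pos b); nra. }
unfold sin_coef, cos_coef, distribution_of; split.
- eapply Hs; [apply sin_mode_by_parts|]. apply RInt_abs_le.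
  + intros x; apply continuous_Rmult; trivial using continuous_cos_mode.
  + intros x Hx; apply Hb; [now apply HM|]. apply Rabs_le, COS_bound.
- eapply Hs; [apply cos_mode_by_parts|].
  rewrite Rabs_Ropp; apply RInt_abs_le.
  + intros x; apply continuous_Rmult; trivial using continuous_sin_mode.
  + intros x Hx; apply Hb; [now apply HM|]. apply Rabs_le, SIN_bound.
Qed.

End Coefficients.

(** Comparison with the telescoping series of 2 (1/k - 1/(k+1)). *)
Lemma ex_series_inv_square : ex_series (fun n => / INR (S n) ^ 2).
Proof.
apply (ex_series_le (K := R_AbsRing) (V := R_CompleteNormedModule) _
  (fun n => 2 * (/ INR (S n) - / INR (S (S n))))).
- intros n; change (Rabs (/ INR (S n) ^ 2) <= 2 * (/ INR (S n) - / INR (S (S n)))).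
  rewrite (S_INR (S n)), (S_INR n); set (x := INR n + 1).
  assert (Hx : 1 <= x) by (unfold x; generalize (pos_INR n); lra).
  rewrite Rabs_pos_eq.
  + replace (2 * (/ x - / (x + 1))) with (/ (x * ((x + 1) / 2))) by (field; lra).
    apply Rinv_le_contravar; [nra|].
    nra.
  + left; apply Rinv_0_lt_compat; nra.
- apply (ex_series_scal (K := R_AbsRing) (V := R_NormedModule) 2).
  exists 1; change (is_lim_seq (sum_n (fun n => / INR (S n) - / INR (S (S n)))) 1).
  apply is_lim_seq_ext with (fun n => 1 - / INR (S (S n))).
  + intros n; induction n as [|n IH].
    * rewrite sum_O; simpl; lra.
    * rewrite sum_Sn, <- IH; unfold plus; simpl; ring.
  + replace (Finite 1) with (Rbar_plus (Finite 1) (Rbar_opp (Finite 0)))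
      by (simpl; f_equal; ring).
    apply is_lim_seq_minus' ; [apply is_lim_seq_const|].
    apply (is_lim_seq_incr_1 (fun n => / INR (S n))), (is_lim_seq_incr_1 (fun n => / INR n)).
    apply (is_lim_seq_inv _ p_infty);
      [apply is_lim_seq_INR|discriminate].
Qed.

Lemma Rpower_neg_le (x y e : R) : 0 < x <= y -> e <= 0 -> Rpower y e <= Rpower x e.
Proof.
intros Hxy He; unfold Rpower.
assert (Hl : ln x <= ln y) by (apply ln_le; lra).
destruct (Rle_lt_or_eq_dec (e * ln y) (e * ln x)) as [H|H]; [nra| |].
- left; now apply exp_increasing.
- rewrite H; apply Rle_refl.
Qed.

Lemma Hdot_term_nonneg (r : R) (F : (R -> R) -> R) (n : nat) : 0 <= Hdot_term r F n.
Proof.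
apply Rmult_le_pos; [left; apply exp_pos|].
apply Rplus_le_le_0_compat; apply pow2_ge_0.
Qed.

Lemma test_function_continuous (phi : R -> R) (x : R) :
  test_function phi -> continuous phi x.
Proof.
intros [Hs _]; apply (ex_derive_continuous (V := R_NormedModule)), (Hs 1%nat x).
Qed.

Lemma distribution_of_continuous (f : R -> R) :
  (forall x, continuous f x) -> periodic_distribution (distribution_of f).
Proof.
intros Cf; split.
- intros a b phi psi Hphi Hpsi; unfold distribution_of; apply is_RInt_eq.
  apply is_RInt_Rext with (fun x => a * (f x * phi x) + b * (f x * psi x)).
  { intros; ring. }
  apply is_RInt_Rplus; apply is_RInt_Rscal, is_RInt_continuous; intros x;
    apply continuous_Rmult; trivial; now apply test_function_continuous.
- destruct (continuous_bounded f Cf) as (M & HM).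
  exists 0%nat, (2 * PI * M); intros phi N Hphi HN.
  rewrite Rmult_assoc; apply RInt_abs_le.
  + intros x; apply continuous_Rmult; trivial; now apply test_function_continuous.
  + intros x Hx; rewrite Rabs_mult.
    apply Rmult_le_compat; try apply Rabs_pos; [now apply HM|].
    exact (HN 0%nat x (Nat.le_refl _)).
Qed.

Lemma in_Hdot_of_C1 (r : R) (f f' : R -> R) :
  r < 0 -> periodic f -> (forall x, is_derive f x (f' x)) ->
  (forall x, continuous f' x) -> mean_zero f -> in_Hdot r (distribution_of f).
Proof.
intros Hr Pf Df Cf' Hf; split; [|split].
- apply distribution_of_continuous; intros x; exact (is_derive_continuous f x _ (Df x)).
- unfold distribution_of; apply is_RInt_eq.
  apply is_RInt_Rext with f; [intros; ring|exact Hf].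
- destruct (coefficient_decay f f' Pf Df Cf') as (C & HC & Hdec).
  apply (ex_series_le (K := R_AbsRing) (V := R_CompleteNormedModule) _
           (fun n => (2 * C ^ 2) * / INR (S n) ^ 2)).
  + intros n; change (norm (Hdot_term r (distribution_of f) n))
      with (Rabs (Hdot_term r (distribution_of f) n)).
    rewrite Rabs_pos_eq by apply Hdot_term_nonneg.
    destruct (Hdec n) as [Hs Hc].
    assert (Hn : 1 <= INR (S n)) by (rewrite S_INR; generalize (pos_INR n); lra).
    assert (Hp : Rpower (INR (S n)) (2 * r) <= 1).
    { replace 1 with (Rpower 1 (2 * r)) by (unfold Rpower; rewrite ln_1, Rmult_0_r; apply exp_0).
      apply Rpower_neg_le; lra. }
    assert (Hsq : forall x, Rabs x <= C / INR (S n) ->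
                    Rabs x ^ 2 <= C ^ 2 * / INR (S n) ^ 2).
    { intros x Hx; replace (C ^ 2 * / INR (S n) ^ 2) with ((C / INR (S n)) ^ 2)
        by (field; lra).
      apply pow_incr; split; [apply Rabs_pos|exact Hx]. }
    apply Hsq in Hs; apply Hsq in Hc.
    unfold Hdot_term.
    set (S1 := Rabs (sin_coef _ _) ^ 2) in *; set (S2 := Rabs (cos_coef _ _) ^ 2) in *.
    assert (0 <= S1) by apply pow2_ge_0; assert (0 <= S2) by apply pow2_ge_0.
    apply Rle_trans with (1 * (S1 + S2)); [apply Rmult_le_compat_r; lra|lra].
  + apply (ex_series_scal (K := R_AbsRing) (V := R_NormedModule) (2 * C ^ 2)).
    apply ex_series_inv_square.
Qed.

Lemma is_series_single (m : nat) (c : R) :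
  is_series (fun n => if Nat.eqb n m then c else 0) c.
Proof.
assert (Hlt : forall n, (n < m)%nat ->
          sum_n (fun n => if Nat.eqb n m then c else 0) n = 0).
{ induction n as [|n IH]; intros Hn.
  - rewrite sum_O; destruct (Nat.eqb_spec 0 m); [lia|reflexivity].
  - rewrite sum_Sn, IH by lia.
    destruct (Nat.eqb_spec (S n) m); [lia|apply Rplus_0_l]. }
assert (Hge : forall n, (m <= n)%nat ->
          sum_n (fun n => if Nat.eqb n m then c else 0) n = c).
{ intros n Hn; induction Hn as [|n Hn IH].
  - destruct m as [|m]; [now rewrite sum_O|].
    rewrite sum_Sn, Hlt, Nat.eqb_refl by lia; apply Rplus_0_l.
  - rewrite sum_Sn, IH; destruct (Nat.eqb_spec (S n) m); [lia|apply Rplus_0_r]. }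
change (is_lim_seq (sum_n (fun n => if Nat.eqb n m then c else 0)) c).
apply is_lim_seq_ext_loc with (fun _ => c); [|apply is_lim_seq_const].
exists m; intros n Hn; now rewrite Hge.
Qed.

(** The frequency 1 has weight 1 whatever r is. *)
Lemma Hdot_norm_ge_first_mode (r : R) (F : (R -> R) -> R) :
  ex_series (Hdot_term r F) -> Rabs (sin_coef F 1) <= Hdot_norm r F.
Proof.
intros Hex; unfold Hdot_norm.
rewrite <- (sqrt_pow2 (Rabs (sin_coef F 1))) by apply Rabs_pos.
apply sqrt_le_1_alt.
apply Rle_trans with (Hdot_term r F 0).
- unfold Hdot_term; simpl (INR 1).
  replace (Rpower 1 (2 * r)) with 1
    by (unfold Rpower; rewrite ln_1, Rmult_0_r; symmetry; apply exp_0).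
  generalize (pow2_ge_0 (Rabs (cos_coef F 1))); lra.
- rewrite <- (is_series_unique _ _ (is_series_single 0 (Hdot_term r F 0))).
  apply Series_le; [|exact Hex].
  intros [|n]; simpl; split; try apply Rle_refl; apply Hdot_term_nonneg.
Qed.

(** * Two-frequency initial data *)

Lemma INR_sqr_neq (a b : nat) : a <> b -> INR a ^ 2 - INR b ^ 2 <> 0.
Proof.
intros Hab H.
assert (H' : (INR a - INR b) * (INR a + INR b) = 0) by (rewrite <- H; ring).
apply Rmult_integral in H'; destruct H' as [H'|H'].
- apply Hab, INR_eq; lra.
- assert (Ha := pos_INR a); assert (Hb := pos_INR b).
  apply Hab, INR_eq; lra.
Qed.

(** The antiderivatives here and in [is_RInt_cos_sin] are written without the sum
    and difference frequencies, which keeps all frequencies natural numbers. *)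
Lemma is_RInt_cos_cos_neq (a b : nat) :
  a <> b -> is_RInt (fun x => cos (INR a * x) * cos (INR b * x)) 0 (2 * PI) 0.
Proof.
intros Hab; assert (H := INR_sqr_neq a b Hab).
apply (is_RInt_periodic_derivative
  (fun x => (INR a * (sin (INR a * x) * cos (INR b * x))
             - INR b * (cos (INR a * x) * sin (INR b * x)))
            / (INR a ^ 2 - INR b ^ 2))).
- intros x; rewrite (sin_mode_periodic a x), (cos_mode_periodic a x),
    (sin_mode_periodic b x), (cos_mode_periodic b x); reflexivity.
- intros x; auto_derive; [exact I|field; lra].
- intros x; apply continuous_Rmult; apply continuous_cos_mode.
Qed.

Lemma is_RInt_cos_sin (a b : nat) :
  is_RInt (fun x => cos (INR a * x) * sin (INR b * x)) 0 (2 * PI) 0.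
Proof.
assert (Hc : forall x, continuous (fun x => cos (INR a * x) * sin (INR b * x)) x).
{ intros x; apply continuous_Rmult;
    [apply continuous_cos_mode|apply continuous_sin_mode]. }
destruct (Nat.eq_dec a b) as [<-|Hab]; [destruct a as [|a]|].
- apply is_RInt_Rext with (fun _ => 0).
  { intros x; simpl; rewrite Rmult_0_l, sin_0; ring. }
  replace 0 with ((2 * PI - 0) * 0) at 2 by ring.
  apply (is_RInt_const (V := R_NormedModule)).
- assert (Ha : INR (S a) <> 0) by now apply not_0_INR.
  apply (is_RInt_periodic_derivative
    (fun x => sin (INR (S a) * x) * sin (INR (S a) * x) / (2 * INR (S a)))).
  + intros x; rewrite (sin_mode_periodic (S a) x); reflexivity.
  + intros x; set (c := INR (S a)) in *; auto_derive; [exact I|field; exact Ha].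
  + exact Hc.
- assert (H := INR_sqr_neq a b Hab).
  apply (is_RInt_periodic_derivative
    (fun x => (INR b * (cos (INR a * x) * cos (INR b * x))
               + INR a * (sin (INR a * x) * sin (INR b * x)))
              / (INR a ^ 2 - INR b ^ 2))); [| |exact Hc].
  + intros x; rewrite (sin_mode_periodic a x), (cos_mode_periodic a x),
      (sin_mode_periodic b x), (cos_mode_periodic b x); reflexivity.
  + intros x; auto_derive; [exact I|field; lra].
Qed.

Lemma is_RInt_cos_cos_same (a : nat) :
  (1 <= a)%nat ->
  is_RInt (fun x => cos (INR a * x) * cos (INR a * x)) 0 (2 * PI) PI.
Proof.
intros Ha; assert (Ha0 : INR a <> 0) by (apply not_0_INR; lia).
apply is_RInt_Rext with
  (fun x => / 2 + (cos (INR a * x) * cos (INR a * x) - / 2)).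
{ intros x; ring. }
replace PI with ((2 * PI - 0) * / 2 + 0) at 2 by field.
apply is_RInt_Rplus; [apply (is_RInt_const (V := R_NormedModule))|].
apply (is_RInt_periodic_derivative
  (fun x => sin (INR a * x) * cos (INR a * x) / (2 * INR a))).
- intros x; rewrite (sin_mode_periodic a x), (cos_mode_periodic a x); reflexivity.
- intros x; auto_derive; [exact I|].
  generalize (sin2_cos2 (INR a * x)); unfold Rsqr; intros Hsc.
  replace (/ 2) with ((sin (INR a * x) * sin (INR a * x) +
    cos (INR a * x) * cos (INR a * x)) / 2) by (rewrite Hsc; field).
  field; exact Ha0.
- intros x; apply (continuous_minus (K := R_AbsRing) (V := R_NormedModule)).
  + apply continuous_Rmult; apply continuous_cos_mode.
  + apply continuous_const.
Qed.

(** Two neighbouring frequencies, so that their difference is the frequency 1. *)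
Definition packet (A : R) (k : nat) (x : R) : R :=
  A * (cos (INR k * x) + cos (INR (S k) * x)).

Lemma packet_periodic (A : R) (k : nat) : periodic (packet A k).
Proof.
intros x; unfold packet.
now rewrite (cos_mode_periodic k x), (cos_mode_periodic (S k) x).
Qed.

Lemma packet_abs_le (A : R) (k : nat) (x : R) : 0 <= A -> Rabs (packet A k x) <= 2 * A.
Proof.
intros HA; unfold packet.
assert (H1 := COS_bound (INR k * x)); assert (H2 := COS_bound (INR (S k) * x)).
apply Rabs_le; split; nra.
Qed.

(** The span of cos (c x) and sin (c x) is stable under differentiation. *)
Lemma sinusoid_Derive_n (a b c : R) (n : nat) :
  exists a' b', forall x,
    Derive_n (fun y => a * cos (c * y) + b * sin (c * y)) n x =
    a' * cos (c * x) + b' * sin (c * x).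
Proof.
induction n as [|n (a' & b' & IH)]; [now exists a, b|].
exists (c * b'), (- (c * a')); intros x; simpl.
rewrite (Derive_ext _ _ x IH).
apply is_derive_unique; auto_derive; [exact I|ring].
Qed.

Lemma sinusoid_smooth (a b c : R) : smooth (fun y => a * cos (c * y) + b * sin (c * y)).
Proof.
intros [|n] x; [exact I|].
destruct (sinusoid_Derive_n a b c n) as (a' & b' & H); simpl.
apply ex_derive_ext with (fun y => a' * cos (c * y) + b' * sin (c * y)).
- intros y; symmetry; apply H.
- auto_derive; exact I.
Qed.

Lemma packet_smooth (A : R) (k : nat) : smooth (packet A k).
Proof.
intros n x.
apply ex_derive_n_ext with
  (fun y => (A * cos (INR k * y) + 0 * sin (INR k * y)) +
            (A * cos (INR (S k) * y) + 0 * sin (INR (S k) * y))).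
{ intros y; unfold packet; ring. }
apply ex_derive_n_plus; apply filter_forall; intros y m _; apply sinusoid_smooth.
Qed.

Lemma packet_derivable (A : R) (k : nat) :
  exists f', (forall x, is_derive (packet A k) x (f' x)) /\ forall x, continuous f' x.
Proof.
exists (fun x => - A * (INR k * sin (INR k * x) + INR (S k) * sin (INR (S k) * x))).
split; intros x.
- unfold packet; set (c := INR (S k)); auto_derive; [exact I|ring].
- apply (ex_derive_continuous (V := R_NormedModule)).
  set (c := INR (S k)); auto_derive; exact I.
Qed.

Lemma is_RInt_packet_cos (A : R) (k m : nat) :
  (1 <= k)%nat ->
  is_RInt (fun x => packet A k x * cos (INR m * x)) 0 (2 * PI)
    (PI * ((if Nat.eqb m k then A else 0) + (if Nat.eqb m (S k) then A else 0))).
Proof.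
intros Hk.
assert (H : forall a, (1 <= a)%nat ->
  is_RInt (fun x => A * (cos (INR a * x) * cos (INR m * x))) 0 (2 * PI)
    (PI * (if Nat.eqb m a then A else 0))).
{ intros a Ha; destruct (Nat.eqb_spec m a) as [->|Hma].
  - rewrite (Rmult_comm PI A); now apply is_RInt_Rscal, is_RInt_cos_cos_same.
  - rewrite Rmult_0_r; replace 0 with (A * 0) at 2 by ring.
    apply is_RInt_Rscal, is_RInt_cos_cos_neq; auto. }
rewrite Rmult_plus_distr_l.
apply is_RInt_Rext with (fun x => A * (cos (INR k * x) * cos (INR m * x)) +
   A * (cos (INR (S k) * x) * cos (INR m * x))).
{ intros x; unfold packet; ring. }
apply is_RInt_Rplus; apply H; lia.
Qed.

Lemma packet_cos_coef (A : R) (k m : nat) :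
  (1 <= k)%nat ->
  cos_coef (distribution_of (packet A k)) m =
  (if Nat.eqb m k then A else 0) + (if Nat.eqb m (S k) then A else 0).
Proof.
intros Hk; unfold cos_coef, distribution_of.
rewrite (is_RInt_eq _ _ _ _ (is_RInt_packet_cos A k m Hk)).
field; apply PI_neq0.
Qed.

Lemma packet_sin_coef (A : R) (k m : nat) :
  sin_coef (distribution_of (packet A k)) m = 0.
Proof.
unfold sin_coef, distribution_of.
rewrite (is_RInt_eq _ 0 (2 * PI) (A * 0 + A * 0)).
- field; apply PI_neq0.
- apply is_RInt_Rext with (fun x => A * (cos (INR k * x) * sin (INR m * x)) +
    A * (cos (INR (S k) * x) * sin (INR m * x))).
  { intros x; unfold packet; ring. }
  apply is_RInt_Rplus; apply is_RInt_Rscal, is_RInt_cos_sin.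
Qed.

Lemma packet_mean_zero (A : R) (k : nat) : (1 <= k)%nat -> mean_zero (packet A k).
Proof.
intros Hk; assert (H := is_RInt_packet_cos A k 0 Hk).
destruct k as [|k]; [lia|]; simpl Nat.eqb in H; cbv iota in H.
unfold mean_zero; replace 0 with (PI * (0 + 0)) at 2 by ring.
refine (is_RInt_Rext _ _ _ _ _ _ H).
intros x; simpl (INR 0); rewrite Rmult_0_l, cos_0; ring.
Qed.

(** The source of the growth: multiplying by cos x shifts the frequencies k and
    k+1 by one, so that cos kx cos x meets cos (k+1)x. *)
Lemma is_RInt_packet_sqr_cos (A : R) (k : nat) :
  (1 <= k)%nat ->
  is_RInt (fun x => packet A k x ^ 2 * cos x) 0 (2 * PI) (PI * A ^ 2).
Proof.
intros Hk.
set (P := fun a b : nat => fun x => cos (INR a * x) * cos (INR b * x)).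
assert (Hcc : forall (a : nat) x, cos (INR (S a) * x) * cos x =
          / 2 * (cos (INR (S (S a)) * x) + cos (INR a * x))).
{ intros a x; rewrite !S_INR.
  replace ((INR a + 1 + 1) * x) with ((INR a + 1) * x + x) by ring.
  replace (INR a * x) with ((INR a + 1) * x - x) by ring.
  rewrite cos_plus, cos_minus; field. }
destruct k as [|k]; [lia|].
apply is_RInt_Rext with (fun x =>
  A ^ 2 * (/ 2 * (P (S k) (S (S k)) x + P (S k) k x) +
           / 2 * (P (S (S k)) (S (S (S k))) x + P (S (S k)) (S k) x) +
           (P (S (S k)) (S (S k)) x + P (S (S k)) k x))).
{ intros x; unfold packet, P.
  set (c0 := cos (INR k * x)).
  assert (H1 := Hcc k x); assert (H2 := Hcc (S k) x); fold c0 in H1.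
  set (c1 := cos (INR (S k) * x)) in *; set (c2 := cos (INR (S (S k)) * x)) in *.
  set (c3 := cos (INR (S (S (S k))) * x)) in *.
  transitivity (A ^ 2 * (c1 * (c1 * cos x) + c2 * (c2 * cos x) + 2 * c2 * (c1 * cos x)));
    [rewrite H1, H2; field|ring]. }
rewrite (Rmult_comm PI); apply is_RInt_Rscal.
replace PI with (/ 2 * (0 + 0) + / 2 * (0 + 0) + (PI + 0)) at 2 by field.
apply is_RInt_Rplus; [apply is_RInt_Rplus; apply is_RInt_Rscal|];
  apply is_RInt_Rplus; try (apply is_RInt_cos_cos_neq; lia).
apply is_RInt_cos_cos_same; lia.
Qed.

(** The only frequencies present are k and k+1, with weights at most k^(2r). *)
Lemma packet_Hdot_norm_le (r A : R) (k : nat) :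
  r < 0 -> (1 <= k)%nat ->
  Hdot_norm r (distribution_of (packet A k)) <=
  sqrt (2 * A ^ 2 * Rpower (INR k) (2 * r)).
Proof.
intros Hr Hk; unfold Hdot_norm; apply sqrt_le_1_alt.
set (w := fun k => Rpower (INR k) (2 * r) * A ^ 2).
assert (HS : is_series (Hdot_term r (distribution_of (packet A k))) (w k + w (S k))).
{ destruct k as [|k]; [lia|].
  apply is_series_ext with (fun n => plus (if Nat.eqb n k then w (S k) else 0)
                                     (if Nat.eqb n (S k) then w (S (S k)) else 0)).
  - intros n; unfold Hdot_term; rewrite packet_sin_coef, packet_cos_coef by exact Hk.
    rewrite Rabs_R0, pow2_abs.
    change (Nat.eqb (S n) (S k)) with (Nat.eqb n k).
    change (Nat.eqb (S n) (S (S k))) with (Nat.eqb n (S k)).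
    unfold w, plus; simpl plus.
    destruct (Nat.eqb_spec n k) as [H1|H1], (Nat.eqb_spec n (S k)) as [H2|H2];
      try lia; rewrite ?H1, ?H2; simpl; ring.
  - apply (is_series_plus (K := R_AbsRing) (V := R_NormedModule));
      apply is_series_single. }
rewrite (is_series_unique _ _ HS); unfold w.
assert (Hk1 : 1 <= INR k) by now apply (le_INR 1 k).
assert (Hp : Rpower (INR (S k)) (2 * r) <= Rpower (INR k) (2 * r)).
{ apply Rpower_neg_le; [rewrite S_INR|]; lra. }
generalize (pow2_ge_0 A); nra.
Qed.

(** * Functions of time known at positive times *)

(** Mean value theorem on [s, T] with s tending to 0: the derivative is known at
    positive times only, and f is merely right-continuous at 0. *)
Lemma growth_from_zero (f f' : R -> R) (a T : R) :
  0 <= T ->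
  (forall t, 0 < t <= T -> is_derive f t (f' t)) ->
  (forall eps, 0 < eps -> exists h, 0 < h /\
     forall t, 0 <= t <= h -> Rabs (f t - f 0) <= eps) ->
  (forall t, 0 < t <= T -> a <= f' t) ->
  f 0 + a * T <= f T.
Proof.
intros HT Hd Hc Ha.
destruct (Rle_lt_or_eq_dec _ _ HT) as [HT'|<-]; [|lra].
apply Rnot_lt_le; intros Hlt.
set (gap := f 0 + a * T - f T).
assert (Hgap : 0 < gap) by (unfold gap; lra).
destruct (Hc (gap / 4)) as (h & Hh & Hf); [lra|].
assert (Ha0 := Rabs_pos a).
set (d := gap / (4 * (Rabs a + 1))).
assert (Hd0 : 0 < d) by (apply Rdiv_lt_0_compat; lra).
set (s := Rmin (Rmin h T) d).
assert (Hs : 0 < s /\ s <= h /\ s <= T /\ s <= d).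
{ unfold s; generalize (Rmin_l (Rmin h T) d) (Rmin_r (Rmin h T) d)
    (Rmin_l h T) (Rmin_r h T).
  intros; repeat split; try lra; repeat apply Rmin_glb_lt; lra. }
destruct Hs as (Hs0 & Hsh & HsT & Hsd).
assert (Hfs := proj1 (Rabs_le_between _ _) (Hf s ltac:(lra))).
assert (Has : a * s <= gap / 4).
{ apply Rle_trans with (Rabs a * d).
  - generalize (Rle_abs a); nra.
  - apply Rle_trans with ((Rabs a + 1) * d); [nra|].
    unfold d; right; field; lra. }
destruct (MVT_gen f s T f') as (c & Hc1 & Hc2).
- intros x Hx; rewrite Rmin_left, Rmax_right in Hx by lra; apply Hd; lra.
- intros x Hx; rewrite Rmin_left, Rmax_right in Hx by lra.
  apply continuity_pt_filterlim, (is_derive_continuous f x (f' x)), Hd; lra.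
- rewrite Rmin_left, Rmax_right in Hc1 by lra.
  assert (Hac := Ha c ltac:(lra)).
  assert (a * (T - s) <= f T - f s) by (rewrite Hc2; apply Rmult_le_compat_r; lra).
  unfold gap in *; lra.
Qed.

Lemma displacement_from_zero (f f' : R -> R) (b T : R) :
  0 <= T ->
  (forall t, 0 < t <= T -> is_derive f t (f' t)) ->
  (forall eps, 0 < eps -> exists h, 0 < h /\
     forall t, 0 <= t <= h -> Rabs (f t - f 0) <= eps) ->
  (forall t, 0 < t <= T -> Rabs (f' t) <= b) ->
  Rabs (f T - f 0) <= b * T.
Proof.
intros HT Hd Hc Hb; apply Rabs_le; split.
- assert (H := growth_from_zero f f' (- b) T HT Hd Hc
    (fun t Ht => proj1 (proj1 (Rabs_le_between _ _) (Hb t Ht)))); lra.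
- assert (H : - f 0 + - b * T <= - f T); [|lra].
  apply (growth_from_zero (fun t => - f t) (fun t => - f' t)); trivial.
  + intros t Ht; apply (is_derive_opp (K := R_AbsRing) (V := R_NormedModule)); auto.
  + intros eps Heps; destruct (Hc eps Heps) as (h & Hh & H).
    exists h; split; trivial; intros t Ht.
    replace (- f t - - f 0) with (- (f t - f 0)) by ring.
    rewrite Rabs_Ropp; auto.
  + intros t Ht; generalize (proj1 (Rabs_le_between _ _) (Hb t Ht)); lra.
Qed.

(** The continuity in [smooth_partials]: relative to t >= 0, at every point of
    that closed half-plane. *)
Definition half_plane_continuous (f : R -> R -> R) : Prop :=
  forall x t, 0 <= t ->
    filterlim (fun p : R * R => f (fst p) (snd p))
      (within (fun p : R * R => 0 <= snd p) (locally (x, t)))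
      (locally (f x t)).

(** Freezing f at its value at t = 0 for negative times yields a function that is
    continuous on the whole plane, to which compactness results apply. *)
Lemma half_plane_extension (f : R -> R -> R) (x t : R) :
  half_plane_continuous f ->
  continuity_2d_pt (fun y s => f y (Rmax 0 s)) x t.
Proof.
intros Hf; apply continuity_2d_pt_filterlim.
apply (filterlim_comp _ _ _ (fun p : R * R => (fst p, Rmax 0 (snd p)))
         (fun p => f (fst p) (snd p)) _
         (within (fun p : R * R => 0 <= snd p) (locally (x, Rmax 0 t))));
  [|exact (Hf x (Rmax 0 t) (Rmax_l 0 t))].
intros P [eps HP]; exists eps; intros [y s] [Hy Hs]; apply HP.
- split; [exact Hy|].
  change (Rabs (s - t) < eps) in Hs; change (Rabs (Rmax 0 s - Rmax 0 t) < eps).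
  apply Rle_lt_trans with (2 := Hs).
  unfold Rmax; destruct (Rle_dec 0 s), (Rle_dec 0 t);
    unfold Rabs; repeat destruct Rcase_abs; lra.
- apply Rmax_l.
Qed.

Lemma uniform_time_continuity (f : R -> R -> R) (T eps : R) :
  half_plane_continuous f -> 0 < eps ->
  exists h, 0 < h /\ forall x s t, 0 <= x <= 2 * PI -> 0 <= s <= T -> 0 <= t <= T ->
    Rabs (t - s) <= h -> Rabs (f x t - f x s) <= eps.
Proof.
intros Hf Heps.
destruct (uniform_continuity_2d (fun y s => f y (Rmax 0 s)) 0 (2 * PI) 0 T
  (fun x t _ _ => half_plane_extension f x t Hf) (mkposreal eps Heps)) as (d & Hd).
assert (Hd0 := cond_pos d).
exists (d / 2); split; [lra|]; intros x s t Hx Hs Ht Hst.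
assert (H := Hd x s x t Hx Hs Hx Ht).
simpl in H; rewrite !Rmax_right in H by lra.
left; apply H; [rewrite Rminus_diag, Rabs_R0|]; lra.
Qed.

Lemma half_plane_interior (f : R -> R -> R) (x t : R) :
  half_plane_continuous f -> 0 < t -> continuity_2d_pt (fun s y => f y s) t x.
Proof.
intros Hf Ht.
apply (continuity_2d_pt_ext_loc (fun s y => f y (Rmax 0 s))).
- exists (mkposreal t Ht); simpl; intros s y Hs _.
  apply Rabs_lt_between in Hs; rewrite Rmax_right by lra; reflexivity.
- intros eps; destruct (half_plane_extension f x t Hf eps) as (d & Hd).
  exists d; intros s y Hs Hy; now apply Hd.
Qed.

(** * A priori estimates for solutions *)

Section Solution.

Variables (u0 : R -> R) (u : R -> R -> R) (D : nat -> nat -> R -> R -> R).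
Hypothesis Hper : forall t, 0 <= t -> periodic (fun x => u x t).
Hypothesis Hinit : forall x, u x 0 = u0 x.
Hypothesis Hsm : smooth_partials u D.
Hypothesis Heq : forall x t, 0 <= t ->
  D 0%nat 1%nat x t + D 1%nat 0%nat x t + u x t * D 1%nat 0%nat x t
  - D 2%nat 1%nat x t = 0.

Let v x t := D 0%nat 1%nat x t.

Lemma solution_continuous : half_plane_continuous u.
Proof.
destruct Hsm as (H0 & _ & _ & Hc); intros x t Ht; rewrite <- (H0 x t Ht).
apply filterlim_within_ext with (2 := Hc 0%nat 0%nat x t Ht).
intros [y s] Hs; now apply H0.
Qed.

Lemma velocity_continuous : half_plane_continuous v.
Proof. destruct Hsm as (_ & _ & _ & Hc); exact (Hc 0%nat 1%nat). Qed.

Lemma solution_space_derivative (t : R) :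
  0 <= t -> forall x, is_derive (fun y => u y t) x (D 1%nat 0%nat x t).
Proof.
destruct Hsm as (H0 & Hx & _); intros Ht x.
apply is_derive_ext with (2 := Hx 0%nat 0%nat x t Ht).
intros y; now apply H0.
Qed.

Lemma solution_time_derivative (x t : R) :
  0 < t -> is_derive (fun s => u x s) t (v x t).
Proof.
destruct Hsm as (H0 & _ & Ht & _); intros Ht0.
apply is_derive_ext_loc with (2 := Ht 0%nat 0%nat x t Ht0).
exists (mkposreal t Ht0); intros s Hs.
apply Rabs_lt_between in Hs; simpl in Hs; unfold minus, plus, opp in Hs; simpl in Hs.
apply H0; lra.
Qed.

Lemma velocity_periodic (t : R) : 0 < t -> periodic (fun x => v x t).
Proof.
intros Ht x.
rewrite <- (is_derive_unique _ _ _ (solution_time_derivative x t Ht)).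
symmetry; apply is_derive_unique.
apply is_derive_ext_loc with (2 := solution_time_derivative (x + 2 * PI) t Ht).
exists (mkposreal t Ht); intros s Hs.
apply Rabs_lt_between in Hs; simpl in Hs; unfold minus, plus, opp in Hs; simpl in Hs.
apply (Hper s); lra.
Qed.

Lemma velocity_elliptic (t : R) :
  0 < t ->
  elliptic_data (fun x => v x t) (fun x => D 1%nat 1%nat x t)
    (fun x => D 2%nat 1%nat x t) (fun x => u x t + u x t ^ 2 / 2)
    (fun x => D 1%nat 0%nat x t + u x t * D 1%nat 0%nat x t).
Proof.
intros Ht; assert (Ht' : 0 <= t) by lra.
destruct Hsm as (_ & Hx & _).
split; [|split; [|split; [|split; [|split]]]].
- now apply velocity_periodic.
- intros x; now rewrite (Hper t Ht' x).
- intros x; now apply (Hx 0%nat 1%nat).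
- intros x; now apply (Hx 1%nat 1%nat).
- intros x; assert (H := solution_space_derivative t Ht' x).
  set (w := fun y => u y t) in *; set (w' := D 1%nat 0%nat x t) in *.
  change (is_derive (fun y => w y + w y ^ 2 / 2) x (w' + w x * w')).
  auto_derive; [repeat split; now exists w'|].
  replace (Derive (fun x => w x) x) with w'
    by (symmetry; apply is_derive_unique; exact H).
  field.
- intros x; generalize (Heq x t Ht'); unfold v; lra.
Qed.

(** For |u| <= 3A, |u + u^2 / 2| <= 3A + (9/2) A^2, at most (15/2) A^2 since
    A >= 1. *)
Lemma velocity_le (A t : R) :
  1 <= A -> 0 < t -> (forall x, Rabs (u x t) <= 3 * A) ->
  forall x, Rabs (v x t) <= 15 / 2 * A ^ 2.
Proof.
intros HA Ht Hu.
apply (elliptic_sup_bound _ _ _ _ _ (15 / 2 * A ^ 2) (velocity_elliptic t Ht)).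
intros x; assert (H := proj1 (Rabs_le_between _ _) (Hu x)).
apply Rabs_le; split; nra.
Qed.

(** Continuity argument in steps of a fixed length h, over which u moves by at
    most A/2.  If the estimate holds up to time n h, then |u - u0| <= A/2 there,
    because (15/2) A^2 T <= A/2; hence |u| <= 2A + A/2 + A/2 up to time (n+1) h,
    and integrating [velocity_le] gives the estimate up to (n+1) h. *)
Lemma solution_near_data (A T : R) :
  1 <= A -> 0 <= T -> 15 * A * T <= 1 -> (forall x, Rabs (u0 x) <= 2 * A) ->
  forall t x, 0 <= t <= T -> Rabs (u x t - u0 x) <= 15 / 2 * A ^ 2 * t.
Proof.
intros HA HT HAT Hu0.
destruct (uniform_time_continuity u T (A / 2) solution_continuous) as (h & Hh & Hosc);
  [lra|].
assert (Hn : forall (n : nat) t x, 0 <= t <= T -> t <= INR n * h ->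
               Rabs (u x t - u0 x) <= 15 / 2 * A ^ 2 * t).
{ induction n as [|n IH]; intros t x Ht Htn.
  - simpl in Htn; replace t with 0 by lra.
    rewrite Hinit, Rminus_diag, Rabs_R0; lra.
  - rewrite S_INR in Htn.
    assert (Hsize : forall s, 0 < s <= t -> forall y, Rabs (u y s) <= 3 * A).
    { intros s Hs; apply periodic_bound; [apply Hper; lra|]; intros y Hy.
      (* An earlier time, at most h before s, that the induction hypothesis covers. *)
      set (s' := Rmax 0 (s - h)).
      assert (Hs' : 0 <= s' <= T /\ s' <= INR n * h /\ Rabs (s - s') <= h).
      { assert (0 <= INR n * h) by (apply Rmult_le_pos; [apply pos_INR|lra]).
        unfold s', Rmax; destruct (Rle_dec 0 (s - h));
          repeat split; try lra; apply Rabs_le; lra. }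
      destruct Hs' as (Hs'T & Hs'n & Hss').
      assert (H1 := IH s' y Hs'T Hs'n).
      assert (H2 := Hosc y s' s Hy Hs'T ltac:(lra) Hss').
      assert (H3 := Hu0 y).
      assert (H4 : 15 / 2 * A ^ 2 * s' <= A / 2) by nra.
      apply Rabs_le_between in H1; apply Rabs_le_between in H2;
      apply Rabs_le_between in H3; apply Rabs_le; lra. }
    assert (Hper' : periodic (fun y => u y t - u0 y)).
    { intros y; rewrite <- !Hinit, (Hper t ltac:(lra) y).
      now rewrite (Hper 0 (Rle_refl 0) y). }
    revert x; apply (periodic_bound _ _ Hper'); intros x Hx.
    rewrite <- Hinit.
    apply (displacement_from_zero (fun s => u x s) (fun s => v x s)); try lra.
    + intros s Hs; apply solution_time_derivative; lra.
    + intros eps Heps.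
      destruct (uniform_time_continuity u 1 eps solution_continuous Heps)
        as (d & Hd & Hcont).
      exists (Rmin d 1); split; [apply Rmin_glb_lt; lra|]; intros s Hs.
      generalize (Rmin_l d 1) (Rmin_r d 1); intros.
      apply Hcont; [exact Hx|lra|lra|apply Rabs_le; lra].
    + intros s Hs; apply velocity_le; trivial; [lra|]; apply Hsize; lra. }
intros t x Ht; destruct (nfloor_ex (t / h)) as (n & Hn1).
{ apply Rmult_le_pos; [lra|left; now apply Rinv_0_lt_compat]. }
apply (Hn (S n)); trivial.
rewrite S_INR; replace t with (t / h * h) by (field; lra).
apply Rmult_le_compat_r; lra.
Qed.

Lemma mode_time_derivative (phi : R -> R) (t : R) :
  (forall x, continuous phi x) -> 0 < t ->
  is_derive (fun s => RInt (fun x => u x s * phi x) 0 (2 * PI)) t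
    (RInt (fun x => v x t * phi x) 0 (2 * PI)).
Proof.
intros Hphi Ht.
assert (HD : forall s x, 0 < s ->
          is_derive (fun z => u x z * phi x) s (v x s * phi x)).
{ intros s x Hs.
  replace (v x s * phi x) with (scal (phi x) (v x s)) by apply Rmult_comm.
  apply is_derive_ext with (fun z => scal (phi x) (u x z)).
  { intros z; apply Rmult_comm. }
  apply is_derive_scal, solution_time_derivative, Hs. }
assert (Hnear : forall s, Rabs (s - t) < t -> 0 < s).
{ intros s Hs; apply Rabs_lt_between in Hs; lra. }
replace (RInt (fun x => v x t * phi x) 0 (2 * PI))
  with (RInt (fun x => Derive (fun z => u x z * phi x) t) 0 (2 * PI))
  by (apply RInt_ext; intros x _; now apply is_derive_unique, HD).
apply (is_derive_RInt_param (fun s x => u x s * phi x)).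
- exists (mkposreal t Ht); intros s Hs x _; exists (v x s * phi x); now apply HD, Hnear.
- intros x _.
  apply (continuity_2d_pt_ext_loc (fun s y => v y s * phi y)).
  + exists (mkposreal t Ht); simpl; intros s y Hs _.
    symmetry; now apply is_derive_unique, HD, Hnear.
  + apply continuity_2d_pt_mult; [apply half_plane_interior; trivial using velocity_continuous|].
    apply (continuity_1d_2d_pt_comp phi (fun _ y => y)); [|apply continuity_2d_pt_id2].
    apply continuity_pt_filterlim, Hphi.
- exists (mkposreal t Ht); intros s Hs; eexists.
  apply is_RInt_continuous; intros x; apply continuous_Rmult; [|apply Hphi].
  apply Hnear in Hs.
  exact (is_derive_continuous _ x _ (solution_space_derivative s (Rlt_le _ _ Hs) x)).
Qed.

Lemma mode_continuous_at_zero (phi : R -> R) :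
  (forall x, continuous phi x) -> (forall x, Rabs (phi x) <= 1) ->
  forall eps, 0 < eps -> exists h, 0 < h /\ forall t, 0 <= t <= h ->
    Rabs (RInt (fun x => u x t * phi x) 0 (2 * PI)
          - RInt (fun x => u x 0 * phi x) 0 (2 * PI)) <= eps.
Proof.
intros Hphi Hphi1 eps Heps; assert (Hpi := two_PI_pos).
destruct (uniform_time_continuity u 1 (eps / (2 * PI)) solution_continuous)
  as (d & Hd & Hcont); [now apply Rdiv_lt_0_compat|].
exists (Rmin d 1); split; [apply Rmin_glb_lt; lra|]; intros t Ht.
generalize (Rmin_l d 1) (Rmin_r d 1); intros.
assert (Hc : forall s, 0 <= s -> forall x, continuous (fun x => u x s * phi x) x).
{ intros s Hs x; apply continuous_Rmult; [|apply Hphi].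
  exact (is_derive_continuous _ x _ (solution_space_derivative s Hs x)). }
assert (Hc' : forall x, continuous (fun x => u x t * phi x + - 1 * (u x 0 * phi x)) x).
{ intros x; apply (continuous_plus (K := R_AbsRing) (V := R_NormedModule));
    [|apply continuous_Rmult; [apply continuous_const|]]; apply Hc; lra. }
replace (_ - _) with (RInt (fun x => u x t * phi x + - 1 * (u x 0 * phi x)) 0 (2 * PI)).
- replace eps with (2 * PI * (eps / (2 * PI))) by (field; lra).
  apply RInt_abs_le; [exact Hc'|]; intros x Hx.
  replace (u x t * phi x + - 1 * (u x 0 * phi x)) with ((u x t - u x 0) * phi x) by ring.
  rewrite Rabs_mult, <- (Rmult_1_r (eps / (2 * PI))).
  apply Rmult_le_compat; try apply Rabs_pos; [|apply Hphi1].
  apply Hcont; [exact Hx|lra|lra|apply Rabs_le; lra].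
- unfold Rminus; rewrite <- (Rmult_1_l (RInt (fun x => u x 0 * phi x) 0 (2 * PI))).
  rewrite Ropp_mult_distr_l.
  apply is_RInt_eq, is_RInt_Rplus; [|apply is_RInt_Rscal]; apply is_RInt_continuous, Hc; lra.
Qed.

(** The velocity is the x-derivative of the periodic flux. *)
Lemma solution_mean_zero (t : R) :
  mean_zero u0 -> 0 <= t -> mean_zero (fun x => u x t).
Proof.
intros H0 Ht.
assert (Hone : forall x, continuous (fun _ : R => 1) x) by (intros; apply continuous_const).
assert (H : Rabs (RInt (fun x => u x t * 1) 0 (2 * PI)
                  - RInt (fun x => u x 0 * 1) 0 (2 * PI)) <= 0 * t).
{ apply (displacement_from_zero (fun s => RInt (fun x => u x s * 1) 0 (2 * PI))
           (fun s => RInt (fun x => v x s * 1) 0 (2 * PI))); trivial.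
  - intros s Hs; apply (mode_time_derivative (fun _ => 1)); [exact Hone|lra].
  - apply (mode_continuous_at_zero (fun _ => 1)); [exact Hone|].
    intros _; rewrite Rabs_R1; lra.
  - intros s Hs; right; rewrite (is_RInt_eq _ 0 (2 * PI) 0); [apply Rabs_R0|].
    apply is_RInt_Rext with (fun x => v x s); [intros; ring|].
    exact (elliptic_mean_zero _ _ _ _ _ (velocity_elliptic s (proj1 Hs))). }
assert (H0' : RInt (fun x => u x 0 * 1) 0 (2 * PI) = 0).
{ apply is_RInt_eq, is_RInt_Rext with (2 := H0); intros x; rewrite Hinit; ring. }
rewrite H0', Rminus_0_r, Rmult_0_l in H.
assert (Hz : RInt (fun x => u x t * 1) 0 (2 * PI) = 0).
{ generalize (Rabs_pos (RInt (fun x => u x t * 1) 0 (2 * PI))); intros Hp.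
  destruct (Req_dec (RInt (fun x => u x t * 1) 0 (2 * PI)) 0) as [E|E]; [exact E|].
  apply Rabs_no_R0 in E; lra. }
unfold mean_zero; rewrite <- Hz at 2.
apply is_RInt_Rext with (fun x => u x t * 1); [intros; ring|].
apply is_RInt_continuous; intros x; apply continuous_Rmult; [|apply Hone].
exact (is_derive_continuous _ x _ (solution_space_derivative t Ht x)).
Qed.

Lemma solution_in_Hdot (r t : R) :
  r < 0 -> mean_zero u0 -> 0 <= t -> in_Hdot r (distribution_of (fun x => u x t)).
Proof.
intros Hr H0 Ht; apply (in_Hdot_of_C1 r _ (fun x => D 1%nat 0%nat x t)); trivial.
- now apply Hper.
- now apply solution_space_derivative.
- intros x; destruct Hsm as (_ & Hx & _).
  exact (is_derive_continuous _ x _ (Hx 1%nat 0%nat x t Ht)).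
- now apply solution_mean_zero.
Qed.

End Solution.

(** * Growth of the first mode and norm inflation *)

(** The rate of change of the integral of u sin x is half the integral of g cos x,
    where g = u + u^2 / 2.  At time 0 the latter is pi A^2 / 2, as the linear
    term has no frequency 1 for k >= 2.  The perturbation is at most
    2 pi A^2 / 8, which leaves a rate of at least pi A^2 / 8. *)
Lemma packet_first_mode_growth (A : R) (k : nat) (T : R) (u : R -> R -> R) :
  1 <= A -> (2 <= k)%nat -> 0 <= T -> 210 * A * T <= 1 ->
  BBM_solution (packet A k) u ->
  A ^ 2 * T / 8 <= sin_coef (distribution_of (fun x => u x T)) 1.
Proof.
intros HA Hk HT HAT (Hper & Hinit & D & Hsm & Heq).
assert (Hpi := PI_RGT_0).
assert (Hu0 : forall x, Rabs (packet A k x) <= 2 * A) by (intros; apply packet_abs_le; lra).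
assert (Hnear := solution_near_data (packet A k) u D Hper Hinit Hsm Heq A T HA HT
                   ltac:(nra) Hu0).
set (g := fun s x => u x s + u x s ^ 2 / 2).
assert (Cg : forall s, 0 <= s -> forall x, continuous (fun x => g s x * cos x) x).
{ intros s Hs x; apply continuous_Rmult; [|apply continuous_cos].
  assert (H := solution_space_derivative u D Hsm s Hs x).
  apply (ex_derive_continuous (V := R_NormedModule)).
  set (w := fun y => u y s) in *.
  change (ex_derive (fun y => w y + w y ^ 2 / 2) x).
  auto_derive; repeat split; eexists; exact H. }
assert (H0 : is_RInt (fun x => g 0 x * cos x) 0 (2 * PI) (PI * A ^ 2 / 2)).
{ apply is_RInt_Rext with (fun x => packet A k x * cos (INR 1 * x)
                                 + / 2 * (packet A k x ^ 2 * cos x)).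
  { intros x; unfold g; simpl (INR 1); rewrite Hinit, Rmult_1_l; field. }
  replace (PI * A ^ 2 / 2) with (PI * (0 + 0) + / 2 * (PI * A ^ 2)) by field.
  apply is_RInt_Rplus; [|apply is_RInt_Rscal, is_RInt_packet_sqr_cos; lia].
  assert (H := is_RInt_packet_cos A k 1 ltac:(lia)).
  destruct (Nat.eqb_spec 1 k), (Nat.eqb_spec 1 (S k)); try lia; exact H. }
assert (Hrate : forall s, 0 < s <= T ->
          PI * A ^ 2 / 8 <= RInt (fun x => D 0%nat 1%nat x s * sin x) 0 (2 * PI)).
{ intros s Hs.
  rewrite (elliptic_sine_mode _ _ _ _ _
             (velocity_elliptic u D Hper Hsm Heq s (proj1 Hs))).
  change (PI * A ^ 2 / 8 <= / 2 * RInt (fun x => g s x * cos x) 0 (2 * PI)).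
  assert (Hs0 : 0 <= s) by lra.
  assert (Hdiff : Rabs (RInt (fun x => g s x * cos x + - 1 * (g 0 x * cos x)) 0 (2 * PI))
                  <= 2 * PI * (A ^ 2 / 8)).
  { apply RInt_abs_le.
    - intros x; apply (continuous_plus (K := R_AbsRing) (V := R_NormedModule)).
      + now apply Cg.
      + apply continuous_Rmult; [apply continuous_const|apply Cg; lra].
    - intros x _; unfold g.
      assert (H1 := Hnear s x ltac:(lra)); assert (H2 := Hu0 x).
      rewrite Hinit; set (w0 := packet A k x) in *; set (w := u x s) in *.
      replace ((w + w ^ 2 / 2) * cos x + - 1 * ((w0 + w0 ^ 2 / 2) * cos x))
        with ((w - w0) * (1 + (w + w0) / 2) * cos x) by field.
      (* (15/2) A^2 T <= (15/2) A / 210 = A / 28, which with (7/2) A makes A^2 / 8. *)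
      assert (H3 : Rabs (w - w0) <= A / 28).
      { apply Rle_trans with (1 := H1).
        apply Rle_trans with (15 / 2 * A * (A * T)); [nra|].
        assert (0 <= A * T <= 1 / 210) by nra; nra. }
      assert (H4 : Rabs (1 + (w + w0) / 2) <= 7 / 2 * A).
      { apply Rabs_le_between in H2; apply Rabs_le_between in H3; apply Rabs_le; lra. }
      assert (H5 : Rabs (cos x) <= 1) by apply Rabs_le, COS_bound.
      rewrite !Rabs_mult.
      replace (A ^ 2 / 8) with (A / 28 * (7 / 2 * A) * 1) by field.
      repeat apply Rmult_le_compat; trivial; try apply Rabs_pos.
      apply Rmult_le_pos; apply Rabs_pos. }
  rewrite (is_RInt_eq _ _ _ _ (is_RInt_Rplus _ _ _ _ _ _
    (is_RInt_continuous _ 0 (2 * PI) (Cg s Hs0)) (is_RInt_Rscal _ _ _ (- 1) _ H0))) in Hdiff.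
  change (Rabs (RInt (fun x => g s x * cos x) 0 (2 * PI) + - 1 * (PI * A ^ 2 / 2))
          <= 2 * PI * (A ^ 2 / 8)) in Hdiff.
  apply Rabs_le_between in Hdiff; lra. }
assert (HF : RInt (fun x => u x 0 * sin x) 0 (2 * PI) + PI * A ^ 2 / 8 * T
             <= RInt (fun x => u x T * sin x) 0 (2 * PI)).
{ apply (growth_from_zero (fun s => RInt (fun x => u x s * sin x) 0 (2 * PI))
           (fun s => RInt (fun x => D 0%nat 1%nat x s * sin x) 0 (2 * PI))); trivial.
  - intros s Hs; apply (mode_time_derivative u D Hsm sin); [apply continuous_sin|lra].
  - apply (mode_continuous_at_zero u D Hsm sin); [apply continuous_sin|].
    intros x; apply Rabs_le, SIN_bound. }
assert (Hsin : forall s, RInt (fun x => u x s * sin x) 0 (2 * PI) =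
                 PI * sin_coef (distribution_of (fun x => u x s)) 1).
{ intros s; unfold sin_coef, distribution_of; simpl (INR 1).
  replace (fun x => u x s * sin (1 * x)) with (fun x => u x s * sin x)
    by (apply functional_extensionality; intros x; now rewrite Rmult_1_l).
  assert (Hcancel : forall I : R, I = PI * (I / PI)) by (intros I; field; lra).
  apply Hcancel. }
rewrite !Hsin in HF.
replace (fun x => u x 0) with (packet A k) in HF
  by (apply functional_extensionality; intros x; now rewrite Hinit).
rewrite packet_sin_coef in HF.
apply Rmult_le_reg_l with PI; [exact Hpi|lra].
Qed.

(** The real number exp (ln eta / (2 r)) is the solution b of b^(2r) = eta; any
    larger frequency has a smaller weight. *)
Definition frequency (r eta : R) : nat :=
  S (S (proj1_sig (nfloor_ex (exp (ln eta / (2 * r))) (Rlt_le _ _ (exp_pos _))))).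

Lemma frequency_ge_2 (r eta : R) : (2 <= frequency r eta)%nat.
Proof. unfold frequency; lia. Qed.

Lemma frequency_Rpower_le (r eta : R) :
  r < 0 -> 0 < eta -> Rpower (INR (frequency r eta)) (2 * r) <= eta.
Proof.
intros Hr Heta; unfold frequency.
destruct (nfloor_ex _ _) as (n & Hn); simpl proj1_sig.
set (b := exp (ln eta / (2 * r))) in *.
replace eta with (Rpower b (2 * r)).
- apply Rpower_neg_le; [|lra].
  split; [apply exp_pos|rewrite !S_INR; lra].
- unfold Rpower, b; rewrite ln_exp.
  replace (2 * r * (ln eta / (2 * r))) with (ln eta) by (field; lra).
  now apply exp_ln.
Qed.

Theorem theorem2p1 (r : R) (hr : r < 0) :
  exists (u0 : nat -> R -> R) (T : nat -> R),
    (forall j : nat, (1 <= j)%nat ->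
       smooth (u0 j) /\ periodic (u0 j) /\ mean_zero (u0 j)) /\
    (forall j : nat, (1 <= j)%nat -> in_Hdot r (distribution_of (u0 j))) /\
    is_lim_seq (fun j => Hdot_norm r (distribution_of (u0 j))) 0 /\
    (forall j : nat, (1 <= j)%nat -> 0 < T j) /\
    is_lim_seq T 0 /\
    (forall (j : nat) (u : R -> R -> R), (1 <= j)%nat ->
       BBM_solution (u0 j) u ->
       in_Hdot r (distribution_of (fun x => u x (T j))) /\
       Hdot_norm r (distribution_of (fun x => u x (T j))) >= INR j).
Proof.
set (A := fun j => 1680 * INR (S j)).
set (k := fun j => frequency r (/ (2 * (A j * INR (S j)) ^ 2))).
assert (Hj : forall j, 1 <= INR (S j)).
{ intros j; rewrite S_INR; generalize (pos_INR j); lra. }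
assert (HA : forall j, 1 <= A j) by (intros j; unfold A; generalize (Hj j); lra).
assert (Hk : forall j, (2 <= k j)%nat) by (intros j; apply frequency_ge_2).
assert (Hk1 : forall j, (1 <= k j)%nat) by (intros j; generalize (Hk j); lia).
assert (Hinv : is_lim_seq (fun j => / INR (S j)) 0).
{ apply (is_lim_seq_incr_1 (fun n => / INR n)), (is_lim_seq_inv _ p_infty);
    [apply is_lim_seq_INR|discriminate]. }
exists (fun j => packet (A j) (k j)), (fun j => / (210 * A j)).
split; [|split; [|split; [|split; [|split]]]].
- intros j _; split; [apply packet_smooth|split].
  + apply packet_periodic.
  + now apply packet_mean_zero.
- intros j _; destruct (packet_derivable (A j) (k j)) as (f' & Hf' & Hc).
  apply (in_Hdot_of_C1 r _ f'); trivial.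
  + apply packet_periodic.
  + now apply packet_mean_zero.
- apply is_lim_seq_le_le with (fun _ => 0) (fun j => / INR (S j));
    [|apply is_lim_seq_const|exact Hinv].
  intros j; split; [apply sqrt_pos|].
  assert (HAj := HA j); assert (Hjj := Hj j).
  apply Rle_trans with (1 := packet_Hdot_norm_le r (A j) (k j) hr (Hk1 j)).
  rewrite <- (sqrt_pow2 (/ INR (S j))) by (left; apply Rinv_0_lt_compat; lra).
  apply sqrt_le_1_alt.
  assert (Hpos : 0 < 2 * (A j * INR (S j)) ^ 2).
  { apply Rmult_lt_0_compat; [lra|apply pow_lt, Rmult_lt_0_compat; lra]. }
  apply Rle_trans with (2 * A j ^ 2 * (/ (2 * (A j * INR (S j)) ^ 2))).
  + apply Rmult_le_compat_l; [generalize (pow2_ge_0 (A j)); lra|].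
    apply frequency_Rpower_le; [exact hr|now apply Rinv_0_lt_compat].
  + right; field; lra.
- intros j _; apply Rinv_0_lt_compat; generalize (HA j); lra.
- apply is_lim_seq_ext with (fun j => / (210 * 1680) * / INR (S j)).
  { intros j; unfold A; field; generalize (Hj j); lra. }
  rewrite <- (Rmult_0_r (/ (210 * 1680))).
  now apply (is_lim_seq_scal_l _ _ 0).
- intros j u _ Hu.
  assert (HAj := HA j).
  assert (HT : 0 < / (210 * A j)) by (apply Rinv_0_lt_compat; lra).
  assert (Hin : in_Hdot r (distribution_of (fun x => u x (/ (210 * A j))))).
  { destruct Hu as (Hper & Hinit & D & Hsm & Heq).
    apply (solution_in_Hdot _ u D Hper Hinit Hsm Heq); [exact hr| |lra].
    now apply packet_mean_zero. }
  split; [exact Hin|].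
  apply Rle_ge, Rle_trans with (2 := Hdot_norm_ge_first_mode r _ (proj2 (proj2 Hin))).
  apply Rle_trans with (2 := Rle_abs _).
  apply Rle_trans with (2 := packet_first_mode_growth (A j) (k j) _ u HAj (Hk j)
    (Rlt_le _ _ HT) ltac:(right; field; lra) Hu).
  replace (A j ^ 2 * / (210 * A j) / 8) with (INR (S j)).
  + rewrite S_INR; lra.
  + unfold A; field; generalize (Hj j); lra.
Qed.
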